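(* Let $p$ be a prime and $n$ an integer, with $n\ge 1$ if $p$ is odd and $n\ge 2$ if $p$ is even (that is, $p=2$). The Laplacian spectrum of the Co-Prime Order graph $\Theta(D_{p^n})$ of the dihedral group $D_{p^n}$ consists of $0$ with multiplicity $1$, $2p^n$ with multiplicity $p+p^n$, and $p+p^n$ with multiplicity $p^n-p-1$.
   Context: For a finite group $G$, the Co-Prime Order graph $\Theta(G)$ is the simple undirected graph with vertex set $G$ in which two distinct vertices $x,y$ are adjacent if and only if $\gcd(o(x),o(y))$ is $1$ or a prime, where $o(x)$ is the order of $x$. The Laplacian matrix of a finite simple graph $\Gamma$ is $L(\Gamma)=D(\Gamma)-A(\Gamma)$, with $D(\Gamma)$ the diagonal matrix of vertex degrees and $A(\Gamma)$ the adjacency matrix; the Laplacian polynomial is the characteristic polynomial of $L(\Gamma)$, and the Laplacian spectrum is the collection of eigenvalues of $L(\Gamma)$ with their multiplicities. $D_m=\{f^ir^j\mid o(f)=2,\ o(r)=m,\ rf=fr^{-1}\}$ denotes the dihedral group with $2m$ elements. *)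

(* Defs.v *)
From HB Require Import structures.
From mathcomp Require Import all_boot all_order all_algebra.
From mathcomp Require Import all_fingroup all_solvable.

Set Implicit Arguments.
Unset Strict Implicit.
Unset Printing Implicit Defensive.

Import GRing.Theory Num.Theory.

(* A finite simple graph is a vertex set V : {set T} together with a symmetric,
   irreflexive relation e, only used on V.  Its matrices are indexed by 'I_#|V|
   through the enumeration enum_val of V. *)
Section GraphLaplacian.

Local Open Scope ring_scope.

Variables (C : numClosedFieldType) (T : finType) (V : {set T}) (e : rel T).

Definition degree (x : T) : nat := #|[set y in V | e x y]|.

Definition adjacency_mx : 'M[C]_#|V| :=
  \matrix_(i, j) (e (enum_val i) (enum_val j))%:R.

Definition degree_mx : 'M[C]_#|V| :=
  diag_mx (\row_i (degree (enum_val i))%:R).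

Definition laplacian_mx : 'M[C]_#|V| := degree_mx - adjacency_mx.

Definition laplacian_poly : {poly C} := char_poly laplacian_mx.

(* The Laplacian spectrum as a multiplicity function: the multiplicity of a
   value that is not an eigenvalue is 0. *)
Definition laplacian_spectrum (a : C) : nat := mup a laplacian_poly.

(* s lists pairs (value, multiplicity).  Values in s may coincide, in which case
   their multiplicities are added; the multiplicities are integers so that a
   formal multiplicity such as q - 1 with q = 0 keeps its value in that sum. *)
Definition laplacian_spectrum_is (s : seq (C * int)) : Prop :=
  forall a : C, (laplacian_spectrum a)%:Z = \sum_(am <- s | am.1 == a) am.2.

End GraphLaplacian.

Section CoprimeOrderGraph.

Variable gT : finGroupType.

Definition coprime_order_adj : rel gT := fun x y =>
  (x != y) && ((gcdn #[x]%g #[y]%g == 1%N) || prime (gcdn #[x]%g #[y]%g)).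

Lemma coprime_order_adj_sym : symmetric coprime_order_adj.
Proof. by move=> x y; rewrite /coprime_order_adj eq_sym gcdnC. Qed.

Lemma coprime_order_adj_irr : irreflexive coprime_order_adj.
Proof. by move=> x; rewrite /coprime_order_adj eqxx. Qed.

End CoprimeOrderGraph.

(* Main.v *)
Require Import Defs.
From mathcomp Require Import all_boot all_order all_algebra.
From mathcomp Require Import all_fingroup all_solvable.
From mathcomp Require Import ring zify.

Set Implicit Arguments.
Unset Strict Implicit.
Unset Printing Implicit Defensive.

Import GRing.Theory Num.Theory.
Local Open Scope ring_scope.

(** Every element of the dihedral group outside the rotation subgroup R, cyclic
    of order p ^ n, is an involution, and every rotation has p-power order.  Let
    S be the set of elements of order 1 or a prime.  The gcd of a prime with
    anything is 1 or that prime, so each element of S is adjacent to all the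
    others; an element outside S is a rotation of order divisible by p ^ 2, so
    two of them are never adjacent.  Hence the graph is the join of a complete
    graph on S with an edgeless graph ([prime_power_dihedral_dominating]).  As R
    has exactly p elements of order dividing p, S has d = p + p ^ n elements
    among N = 2 * p ^ n.

    The Laplacian polynomial chi of such a join is obtained from two rank-one
    updates ([laplacian_poly_complete_split]).  Put M = X - L, let J be the
    all-ones matrix and w the indicator column of the complement of S.  Then
    M - J = D - w w^T, where D is diagonal with entry X - N on S and X - d off
    S, and both updates can be undone by a matrix product:
    - L kills constants, so M (X - J) = X (M - J);
    - D w = (X - d) w, so D ((X - d) - w w^T) = (X - d) (D - w w^T).
    Since [det_scalar_sub_rank1] evaluates det (y - u v), taking determinants
    gives chi (X - d) = X (X - N) ^ d (X - d) ^ (N - d), and multiplicities are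
    read off.  The factor X - d stays on the left because it does not occur on
    the right when N = d, that is for p odd and n = 1, where the announced
    multiplicity p ^ n - p - 1 is -1 and is compensated by the coincidence of
    the two nonzero values. *)

(** * Determinants and Laplacians *)

(** In the bordered matrix with blocks y, u, v and 1, the block v can be cleared
    with the last column, or with the first rows once the last row is multiplied
    by y.  Comparing the two values of the determinant avoids inverting y, at the
    price of a factor y. *)
Lemma det_scalar_sub_rank1 (R : comNzRingType) (n : nat) (y : R)
    (u : 'cV[R]_n) (v : 'rV[R]_n) :
  y * \det (y%:M - u *m v) = y ^+ n * (y - (v *m u) 0 0).
Proof.
pose B := block_mx y%:M u v (1%:M : 'M_1).
have detB : \det B = \det (y%:M - u *m v).
  have : B *m block_mx 1%:M 0 (- v) 1%:M = block_mx (y%:M - u *m v) u 0 1%:M.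
    by rewrite mulmx_block !mulmx1 !mulmx0 !mulmxN mul1mx !add0r subrr.
  move/(congr1 determinant).
  by rewrite det_mulmx det_lblock det_ublock !det1 !mulr1.
have : block_mx 1%:M 0 (- v) y%:M *m B = block_mx y%:M u 0 (y%:M - v *m u).
  rewrite mulmx_block !mul1mx !mul0mx !addr0 mulmx1 !mulNmx mul_mx_scalar.
  by rewrite mul_scalar_mx addNr addrC.
move/(congr1 determinant).
rewrite det_mulmx det_lblock det_ublock det1 mul1r !det_scalar expr1 detB => ->.
by rewrite det_mx11 !mxE eqxx mulr1n.
Qed.

Lemma laplacian_mul_const1 (C : numClosedFieldType) (T : finType) (V : {set T})
    (e : rel T) (m : nat) :
  laplacian_mx C V e *m const_mx 1 = 0 :> 'M_(_, m).
Proof.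
apply/matrixP=> i j; rewrite mulmxBl mul_diag_mx !mxE mulr1.
under eq_bigr do rewrite !mxE mulr1.
rewrite -(@big_enum_val _ _ _ _ (mem V) (fun y => (e (enum_val i) y)%:R)) /=.
rewrite /degree -sum1dep_card natr_sum big_mkcondr /=.
by rewrite -sumrB big1 // => y _; case: (e _ _); rewrite subrr.
Qed.

(** * Join of a complete graph and an edgeless graph *)

Section CompleteSplitGraph.

Variables (C : numClosedFieldType) (T : finType) (V S : {set T}) (e : rel T).
Hypothesis sSV : S \subset V.
Hypothesis eE : {in V &, forall x y,
  e x y = (x != y) && ((x \in S) || (y \in S))}.

Lemma degree_complete_split x : x \in V ->
  degree V e x = (if x \in S then #|V|.-1 else #|S|)%N.
Proof.
move=> Vx; rewrite /degree; case: ifPn => Sx; last first.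
  apply: eq_card => y; rewrite !inE; case Vy: (y \in V) => /=.
    rewrite eE // (negPf Sx) /=.
    by have [<-|//] := eqVneq x y; rewrite (negPf Sx).
  by apply/esym/(contraFF _ Vy); apply: subsetP.
rewrite (cardsD1 x V) Vx /=; apply: eq_card => y; rewrite !inE andbC.
by case Vy: (y \in V); rewrite ?andbF // eE // Sx andbT eq_sym.
Qed.

Local Notation N := #|V|.
Local Notation d := #|S|.

(** The all-ones matrix is peeled off by X - J and the block of ones off S by
    (X - d) - w w^T.  The powers of X and X - d that the two determinant
    identities bring in are cancelled, which leaves the factor X - d on the
    left. *)
Lemma laplacian_poly_complete_split :
  laplacian_poly C V e * ('X - d%:R%:P)
  = 'X * ('X - N%:R%:P) ^+ d * ('X - d%:R%:P) ^+ (N - d).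
Proof.
pose L := laplacian_mx C V e; pose M := char_poly_mx L.
pose u : 'cV[{poly C}]_N := const_mx 1.
pose w : 'cV[{poly C}]_N := \col_i (enum_val i \notin S)%:R.
pose a : {poly C} := 'X - N%:R%:P; pose b : {poly C} := 'X - d%:R%:P.
pose D : 'rV[{poly C}]_N := \row_i (if enum_val i \in S then a else b).
have Mu : M *m u = 'X *: u.
  have -> : u = map_mx polyC (const_mx 1) by rewrite map_const_mx.
  rewrite mulmxBl mul_scalar_mx -map_mxM laplacian_mul_const1.
  by rewrite raddf0 subr0.
have MJ : M - u *m u^T = diag_mx D - w *m w^T.
  apply/matrixP=> i j; rewrite !mxE !big_ord1 !mxE mul1r.
  rewrite eE ?enum_valP // (inj_eq enum_val_inj).
  rewrite degree_complete_split ?enum_valP //.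
  have Vi := enum_valP i.
  have V0 : (0 < #|V|)%N by apply/card_gt0P; exists (enum_val i).
  have [<-|] := eqVneq i j; rewrite ?mulr0n ?mulr1n /=.
    rewrite !subr0; case: ifP => Si /=.
      rewrite mulr0 subr0 /a -{2}(prednK V0) -natr1 polyCD polyC1.
      by rewrite opprD addrA.
    by rewrite mulr1.
  move=> _; case: (_ \in S); case: (_ \in S); rewrite /= ?mulr0 ?mul0r ?mulr1;
    by rewrite ?polyC0 ?polyC1; ring.
have cardVS : #|V :\: S| = (N - d)%N by rewrite cardsDS.
have utu : (u^T *m u) 0 0 = N%:R.
  rewrite !mxE; under eq_bigr do rewrite !mxE mulr1.
  by rewrite sumr_const card_ord.
have wtw : (w^T *m w) 0 0 = (N - d)%:R.
  rewrite !mxE; under eq_bigr do rewrite !mxE -natrM mulnb andbb.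
  rewrite -(@big_enum_val _ _ _ _ (mem V) (fun x => (x \notin S)%:R)) /=.
  rewrite -natr_sum -big_mkcondr /= sum1dep_card -cardVS; congr (_%:R).
  by apply: eq_card => x; rewrite !inE andbC.
have detD : \det (diag_mx D) = a ^+ d * b ^+ (N - d).
  rewrite det_diag; under eq_bigr do rewrite mxE.
  rewrite -(@big_enum_val _ _ _ _ (mem V) (fun x => if x \in S then a else b)).
  rewrite big_if /=.
  rewrite -cardVS !prodr_const; congr (_ ^+ _ * _ ^+ _); apply: eq_card => x.
    by rewrite unfold_in /=; apply/andb_idl/(subsetP sSV).
  by rewrite !inE andbC.
have detM : \det M * a = 'X * \det (diag_mx D - w *m w^T).
  apply: (@mulfI _ ('X ^+ N)); first by rewrite expf_neq0 ?polyX_eq0.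
  have : M *m ('X%:M - u *m u^T) = 'X *: (diag_mx D - w *m w^T).
    by rewrite -MJ mulmxBr mulmxA Mu mul_mx_scalar -scalemxAl -scalerBr.
  move/(congr1 determinant); rewrite det_mulmx detZ.
  move/(congr1 (fun q => 'X * q)); rewrite mulrCA det_scalar_sub_rank1 utu.
  by rewrite /a polyC_natr => E; rewrite mulrCA E mulrCA.
have detw : b * \det (diag_mx D - w *m w^T) = a * \det (diag_mx D).
  apply: (@mulfI _ (b ^+ N)); first by rewrite expf_neq0 ?polyXsubC_eq0.
  have : diag_mx D *m (b%:M - w *m w^T) = b *: (diag_mx D - w *m w^T).
    rewrite mulmxBr mul_mx_scalar scalerBr mulmxA; congr (_ - _).
    rewrite scalemxAl; congr (_ *m _); apply/matrixP=> i j.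
    by rewrite mul_diag_mx !mxE; case: (_ \in S); rewrite ?mulr0.
  move/(congr1 determinant); rewrite det_mulmx detZ.
  move/(congr1 (fun q => b * q)); rewrite mulrCA det_scalar_sub_rank1 wtw.
  have -> : b - (N - d)%:R = a.
    by rewrite /a /b natrB ?subset_leq_card // -!polyC_natr; ring.
  by move=> E; rewrite mulrCA -E; ring.
apply: (@mulfI _ a); first by rewrite polyXsubC_eq0.
rewrite /laplacian_poly /char_poly -/L -/M -/a -/b mulrA [a * _]mulrC detM.
by rewrite -[LHS]mulrA [_ * b in LHS]mulrC detw detD; ring.
Qed.

(** The multiplicity of d is N - d - 1, kept free of subtraction by moving 1 to
    the left-hand side. *)
Lemma laplacian_spectrum_complete_split (a : C) :
  (laplacian_spectrum V e a + (d%:R == a)%R =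
   (0 == a)%R + (if N%:R == a then d else 0%N)%R
     + (if d%:R == a then (N - d)%N else 0%N)%R)%N.
Proof.
have lin (x : C) : mup a ('X - x%:P) = (x == a).
  by rewrite -['X - _]expr1 mup_XsubCX; case: eqP.
have chi0 : laplacian_poly C V e != 0 by rewrite monic_neq0 ?char_poly_monic.
have XsubC_neq0 (x : C) k : ('X - x%:P) ^+ k != 0.
  by rewrite expf_neq0 ?polyXsubC_eq0.
have lin0 : mup a 'X = (0 == a) by rewrite -lin subr0.
have := congr1 (mup a) laplacian_poly_complete_split.
by rewrite !mupM ?mulf_neq0 ?polyX_eq0 ?polyXsubC_eq0 // lin0 lin !mup_XsubCX.
Qed.

End CompleteSplitGraph.

(** * Orders in the dihedral group of a prime power *)

Section Dihedral.
Local Open Scope group_scope.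

(** In the presentation by x and y the group is <[x]> <[y]>, so its order 2q
    forces x to have order q.  Elements outside <[x]> have the form x^i y, and
    square to 1 because y inverts x. *)
Lemma dihedral_rotations (gT : finGroupType) (G : {group gT}) (q : nat) :
  (1 < q)%N -> G \isog 'D_(2 * q) ->
  exists R : {group gT}, [/\ cyclic R, R \subset G, #|R| = q,
    #|G| = (2 * q)%N & {in G :\: R, forall x, #[x] = 2%N}].
Proof.
move=> q_gt1; rewrite mul2n => isoG.
have oG : #|G| = q.*2 by rewrite (card_isog isoG) card_dihedral.
have /existsP[[x y] /= /eqP[defG xq y2 xy]] :
    (G \homg Grp (x : y : x ^+ q, y ^+ 2, x ^ y = x^-1))%g.
  by rewrite -Grp_dihedral ?isog_hom.
have{}defG : (<[x]> * <[y]>)%g = G.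
  by rewrite -norm_joinEr // norms_cycle xy groupV cycle_id.
have oy_le : (#[y]%g <= 2)%N by rewrite dvdn_leq // order_dvdn y2.
have ox : #[x]%g = q.
  apply/eqP; rewrite eqn_leq dvdn_leq ?(ltnW q_gt1) ?order_dvdn ?xq //=.
  rewrite -(leq_pmul2r (ltn0Sn 1)) muln2 -oG -defG.
  rewrite (leq_trans (_ : _ <= #|<[x]>| * #|<[y]>|)%N) //; last first.
    by rewrite leq_mul2l oy_le orbT.
  by rewrite mul_cardG leq_pmulr.
exists <[x]>%G; split; rewrite ?cycle_cyclic ?mul2n //.
  by rewrite -defG mulG_subl.
move=> z /setDP[]; rewrite -defG => /mulsgP[_ v /cycleP[i ->] yv ->{z}] Xv.
have def_v : v = y.
  have /cycleP[j def_v] := yv.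
  rewrite def_v -[j]odd_double_half -mul2n expgD expgM y2 expg1n mulg1 in Xv *.
  by case: (odd j) Xv; rewrite ?expg1 // mulg1 mem_cycle.
rewrite {v yv}def_v in Xv *.
apply: nt_prime_order => //; last by apply: contraNneq Xv => ->; apply: group1.
have yV : (y = y^-1)%g by apply/eqP; rewrite eq_sym eq_invg_mul -expg2 y2.
(* As y is its own inverse, (x^i y)^2 is the product of x^i and (x^i)^y. *)
rewrite expg2 -mulgA {1}yV -conjgE conjXg xy expgVn.
by rewrite mulgV.
Qed.

(** The count of S: its rotations are the solutions of x ^ p = 1 in R, which
    form 'Ohm_1(R), of order p because R is a nontrivial cyclic p-group; the
    p ^ n involutions outside R make up the rest. *)
Lemma prime_power_dihedral_dominating (gT : finGroupType) (G : {group gT})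
    (p n : nat) :
  prime p -> (0 < n)%N -> G \isog 'D_(2 * p ^ n) ->
  let S := [set x in G | (#[x] == 1)%N || prime #[x]] in
  [/\ #|G| = (2 * p ^ n)%N, #|S| = (p + p ^ n)%N &
      {in G &, forall x y,
        coprime_order_adj x y = (x != y) && ((x \in S) || (y \in S))}].
Proof.
move=> p_pr n_gt0 isoG S.
have pn_gt1 : (1 < p ^ n)%N by rewrite -(exp1n n) ltn_exp2r ?prime_gt1.
have [R [cycR sRG oR oG outR]] := dihedral_rotations pn_gt1 isoG.
have pR : p.-group R by rewrite /pgroup oR pnatX pnat_id.
have order_pk x : x \in R -> exists k, #[x] = (p ^ k)%N.
  move=> /order_dvdG; rewrite oR => /(dvdn_pfactor _ _ p_pr)[k _ ->].
  by exists k.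
have p2_dvd x : x \in G -> x \notin S -> (p ^ 2 %| #[x])%N.
  rewrite inE => Gx; rewrite Gx /= => notSx.
  have Rx : x \in R.
    by apply: contraR notSx => R'x; rewrite outR ?orbT // inE R'x.
  have [k ok] := order_pk x Rx; rewrite ok dvdn_exp2l //.
  by case: k ok notSx => [|[|k]] -> //; rewrite expn1 p_pr orbT.
have smallS x m : x \in S -> ((gcdn #[x] m == 1%N) || prime (gcdn #[x] m)).
  rewrite inE => /andP[_ /orP[/eqP-> | pr_x]]; first by rewrite gcd1n.
  have [_ /(_ _ (dvdn_gcdl #[x] m))] := primeP pr_x.
  by case/pred2P=> ->; rewrite ?pr_x ?orbT.
have defS : S = 'Ohm_1(R) :|: (G :\: R).
  rewrite (OhmEabelian pR) ?(abelianS (Ohm_sub _ _)) ?cyclic_abelian //.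
  apply/setP=> x; rewrite !inE -order_dvdn expn1.
  case Rx: (x \in R) => /=; last first.
    by case Gx: (x \in G) => //=; rewrite outR ?orbT // inE Rx.
  rewrite (subsetP sRG) // orbF /=.
  apply/orP/idP=> [[/eqP->//|] | /(primeP p_pr).2].
    have [k ->] := order_pk x Rx.
    case: k => [|k] // pr_pk.
    have : (p %| p ^ k.+1)%N by rewrite expnS dvdn_mulr.
    by rewrite dvdn_prime2 // => /eqP <-.
  by case/pred2P=> ->; [left | right].
split=> // [|x y Gx Gy].
  rewrite defS cardsU (_ : _ :&: _ = set0) ?cards0 ?subn0; last first.
    apply/setP=> x; rewrite !inE.
    by apply/and3P=> [[/(subsetP (Ohm_sub _ _))-> ]].
  rewrite (Ohm1_cyclic_pgroup_prime cycR pR) -?cardG_gt1 ?oR //.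
  by rewrite cardsDS // oG oR mul2n -addnn addnK.
rewrite /coprime_order_adj; congr (_ && _).
have [Sx | nSx] := boolP (x \in S); first by rewrite smallS.
have [Sy | nSy] := boolP (y \in S); first by rewrite gcdnC smallS.
have p2g : (p ^ 2 %| gcdn #[x] #[y])%N by rewrite dvdn_gcd !p2_dvd.
apply: contraTF (p2g) => /orP[/eqP-> | pr_g].
  by rewrite dvdn1 -(expn0 p) eqn_exp2l ?prime_gt1.
have : (p %| gcdn #[x] #[y])%N by apply: dvdn_trans p2g; apply: dvdn_mulr.
rewrite dvdn_prime2 // => /eqP <-.
by rewrite gtnNdvd ?prime_gt0 // (ltn_exp2l 1 2) ?prime_gt1.
Qed.

End Dihedral.

Theorem theorem6 (C : numClosedFieldType) (p n : nat)
    (p_prime : prime p)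
    (n_odd : odd p -> (1 <= n)%N) (n_even : ~~ odd p -> (2 <= n)%N)
    (gT : finGroupType) (G : {group gT})
    (G_dihedral : (G \isog 'D_(2 * p ^ n))%g) :
  laplacian_spectrum_is G (@coprime_order_adj gT)
    [:: (0 : C, 1);
        ((2 * p ^ n)%N%:R, (p + p ^ n)%N%:Z);
        ((p + p ^ n)%N%:R, (p ^ n)%N%:Z - p%:Z - 1)].
Proof.
have n_gt0 : (0 < n)%N.
  by have [/n_odd // | /n_even /ltnW] := boolP (odd p).
have p_le : (p <= p ^ n)%N by rewrite -{1}[p]expn1 leq_exp2l ?prime_gt1.
have [oG oS adjE] :=
  prime_power_dihedral_dominating p_prime n_gt0 G_dihedral.
set S := [set x in G | _] in oS adjE => a.
have sSG : S \subset G by apply/subsetP=> x; rewrite inE => /andP[].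
have := laplacian_spectrum_complete_split sSG adjE a.
rewrite oG oS !big_cons big_nil /=.
(* The listed values may coincide, so the three tests are split separately. *)
by do 3![case: (_ == a) => /=]; lia.
Qed.
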